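(* Let $\phi,\psi$ be modal formulas. Then $\phi\land\neg\psi$ is satisfiable if and only if there is a quasi-model $\mathcal X$ (for $\phi,\psi$) containing a type $\tau=(\tau_L,\tau_R)$ with $\mathrm{nnf}(\phi)\in\tau_L$ and $\mathrm{nnf}(\neg\psi)\in\tau_R$.
   Context: A formula is in negation normal form (NNF) if negation occurs only directly in front of proposition letters (grammar $p\mid\neg p\mid\top\mid\bot\mid\chi\land\chi\mid\chi\lor\chi\mid\Diamond\chi\mid\Box\chi$); $\mathrm{nnf}(\chi)$ is the NNF of $\chi$ obtained by De Morgan and $\neg\Diamond\equiv\Box\neg$, $\neg\Box\equiv\Diamond\neg$. For $\chi$ in NNF, $\mathrm{SUBF}(\chi)$ is defined by $\mathrm{SUBF}(\alpha)=\{\alpha\}$ for $\alpha$ of the form $p,\neg p,\top,\bot$ (so $\mathrm{SUBF}(\neg p)$ does not contain $p$), $\mathrm{SUBF}(\chi_1\circ\chi_2)=\mathrm{SUBF}(\chi_1)\cup\mathrm{SUBF}(\chi_2)\cup\{\chi_1\circ\chi_2\}$ for $\circ\in\{\land,\lor\}$, $\mathrm{SUBF}(\heartsuit\chi)=\mathrm{SUBF}(\chi)\cup\{\heartsuit\chi\}$ for $\heartsuit\in\{\Diamond,\Box\}$. $X\subseteq\mathrm{SUBF}(\chi)$ is locally consistent if: $\chi_1\land\chi_2\in X$ implies $\chi_1,\chi_2\in X$; $\chi_1\lor\chi_2\in X$ implies $\chi_1\in X$ or $\chi_2\in X$; $\bot\notin X$; and no $p,\neg p$ both in $X$. An L-type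 is a locally consistent subset of $\mathrm{SUBF}(\mathrm{nnf}(\phi))$, an R-type a locally consistent subset of $\mathrm{SUBF}(\mathrm{nnf}(\neg\psi))$, and a (combined) type is a pair $\tau=(\tau_L,\tau_R)$ of an L-type and an R-type. $\tau$ is overlap-consistent if there is no letter $p$ with $p\in\tau_L,\neg p\in\tau_R$ or $\neg p\in\tau_L,p\in\tau_R$. For L-types (or R-types) $\tau,\tau'$, $\tau\Rightarrow\tau'$ means $\chi\in\tau'$ whenever $\Box\chi\in\tau$; for combined types, $\tau\Rightarrow\tau'$ means $\tau_L\Rightarrow\tau'_L$ and $\tau_R\Rightarrow\tau'_R$. A quasi-model is a set $\mathcal X$ of combined types such that (1) every $\tau\in\mathcal X$ is overlap-consistent, and (2) for every $\tau\in\mathcal X$, $D\in\{L,R\}$ and $\Diamond\chi\in\tau_D$ there is $\tau'\in\mathcal X$ with $\tau\Rightarrow\tau'$ and $\chi\in\tau'_D$. *)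

(* Defs.v *)
From mathcomp Require Import all_boot.
From mathcomp Require Import classical_sets.

Set Implicit Arguments.
Unset Strict Implicit.
Unset Printing Implicit Defensive.

Local Open Scope classical_set_scope.

Inductive form (A : Type) : Type :=
| Var of A
| Top
| Bot
| Neg of form A
| And of form A & form A
| Or of form A & form A
| Dia of form A
| Box of form A.

Arguments Top {A}.
Arguments Bot {A}.

Record kripke (A : Type) : Type := Kripke {
  world : Type;
  acc : world -> world -> Prop;
  valuation : A -> world -> Prop
}.

Fixpoint sat (A : Type) (M : kripke A) (w : world M) (chi : form A) : Prop :=
  match chi with
  | Var p => valuation p w
  | Top => True
  | Bot => False
  | Neg a => ~ sat w a
  | And a b => sat w a /\ sat w b
  | Or a b => sat w a \/ sat w b
  | Dia a => exists2 v, acc w v & sat v a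
  | Box a => forall v, acc w v -> sat v a
  end.

Definition satisfiable (A : Type) (chi : form A) : Prop :=
  exists (M : kripke A) (w : world M), sat w chi.

Fixpoint is_nnf (A : Type) (chi : form A) : bool :=
  match chi with
  | Var _ | Top | Bot | Neg (Var _) => true
  | Neg _ => false
  | And a b | Or a b => is_nnf a && is_nnf b
  | Dia a | Box a => is_nnf a
  end.

(* [nnf_neg chi] is the negation normal form of [Neg chi]. *)
Fixpoint nnf (A : Type) (chi : form A) {struct chi} : form A :=
  match chi with
  | Var p => Var p
  | Top => Top
  | Bot => Bot
  | Neg a => nnf_neg a
  | And a b => And (nnf a) (nnf b)
  | Or a b => Or (nnf a) (nnf b)
  | Dia a => Dia (nnf a)
  | Box a => Box (nnf a)
  end
with nnf_neg (A : Type) (chi : form A) {struct chi} : form A :=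
  match chi with
  | Var p => Neg (Var p)
  | Top => Bot
  | Bot => Top
  | Neg a => nnf a
  | And a b => Or (nnf_neg a) (nnf_neg b)
  | Or a b => And (nnf_neg a) (nnf_neg b)
  | Dia a => Box (nnf_neg a)
  | Box a => Dia (nnf_neg a)
  end.

Lemma is_nnf_nnf (A : Type) (chi : form A) : is_nnf (nnf chi).
Proof.
suff: is_nnf (nnf chi) && is_nnf (nnf_neg chi) by case/andP.
by elim: chi => //= [a /andP[-> ->]|a /andP[-> ->] b /andP[-> ->]
  |a /andP[-> ->] b /andP[-> ->]].
Qed.

(* Only meaningful for [chi] in negation normal form, where [Neg] is applied
   to letters only: a negated letter is then treated as atomic, so that
   [SUBF (Neg (Var p))] does not contain [Var p]. *)
Fixpoint SUBF (A : Type) (chi : form A) : set (form A) :=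
  match chi with
  | Var _ | Top | Bot | Neg _ => [set chi]
  | And a b | Or a b => SUBF a `|` SUBF b `|` [set chi]
  | Dia a | Box a => SUBF a `|` [set chi]
  end.

Definition locally_consistent (A : Type) (X : set (form A)) : Prop :=
  [/\ forall a b, X (And a b) -> X a /\ X b,
      forall a b, X (Or a b) -> X a \/ X b,
      ~ X Bot
    & forall p, ~ (X (Var p) /\ X (Neg (Var p)))].

Inductive side : Type := L | R.

Definition side_formula (A : Type) (phi psi : form A) (D : side) : form A :=
  match D with L => nnf phi | R => nnf (Neg psi) end.

(* [side_type phi psi L] and [side_type phi psi R] are the L-types and the
   R-types. *)
Definition side_type (A : Type) (phi psi : form A) (D : side)
    (X : set (form A)) : Prop :=
  X `<=` SUBF (side_formula phi psi D) /\ locally_consistent X.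

Definition preType (A : Type) : Type := (set (form A) * set (form A))%type.

Definition component (A : Type) (tau : preType A) (D : side) : set (form A) :=
  match D with L => tau.1 | R => tau.2 end.

Definition combined_type (A : Type) (phi psi : form A) (tau : preType A) : Prop :=
  forall D, side_type phi psi D (component tau D).

Definition overlap_consistent (A : Type) (tau : preType A) : Prop :=
  forall p, ~ (component tau L (Var p) /\ component tau R (Neg (Var p))) /\
            ~ (component tau L (Neg (Var p)) /\ component tau R (Var p)).

Definition side_step (A : Type) (X Y : set (form A)) : Prop :=
  forall chi, X (Box chi) -> Y chi.

Definition step (A : Type) (tau tau' : preType A) : Prop :=
  forall D, side_step (component tau D) (component tau' D).

Definition quasi_model (A : Type) (phi psi : form A)
    (X : set (preType A)) : Prop :=
  [/\ forall tau, X tau -> combined_type phi psi tau,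
      forall tau, X tau -> overlap_consistent tau
    & forall tau D chi, X tau -> component tau D (Dia chi) ->
        exists tau', [/\ X tau', step tau tau' & component tau' D chi]].

(* Main.v *)
(** Soundness: in a model of [phi /\ ~ psi], the types realised by the worlds
    form a quasi-model.  Completeness: the members of a quasi-model, related by
    [step], form a model in which a letter holds at [tau] when it belongs to
    either component of [tau]; overlap consistency is what makes negated letters
    of one component true despite the letters contributed by the other. *)

Require Import Defs.
From mathcomp Require Import all_boot.
From mathcomp Require Import boolp classical_sets.

Set Implicit Arguments.
Unset Strict Implicit.
Unset Printing Implicit Defensive.

Local Open Scope classical_set_scope.

Lemma SUBF_refl (A : Type) (chi : form A) : SUBF chi chi.
Proof. by case: chi => *; [..|right|right|right|right]. Qed.

(** Realised types are cut down to [SUBF], so their closure conditions need immediate subformulas to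
    stay inside that set; with [SUBF_refl] this lemma provides it. *)
Lemma SUBF_trans (A : Type) (a b : form A) : SUBF b a -> SUBF a `<=` SUBF b.
Proof.
elim: b => [p|||b _|b IHb c IHc|b IHb c IHc|b IHb|b IHb] /=;
  try by move=> -> x.
- by move=> [[/IHb|/IHc] sub|->] // x /sub ?; left; [left|right].
- by move=> [[/IHb|/IHc] sub|->] // x /sub ?; left; [left|right].
- by move=> [/IHb sub|->] // x /sub ?; left.
- by move=> [/IHb sub|->] // x /sub ?; left.
Qed.

(** [nnf] and [nnf_neg] are mutually recursive and swap at a negation, so both claims go through one
    induction. *)
Lemma sat_nnf_nnf_neg (A : Type) (M : kripke A) (chi : form A) (w : world M) :
  (sat w (nnf chi) <-> sat w chi) /\ (sat w (nnf_neg chi) <-> ~ sat w chi).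
Proof.
elim: chi w => [p|||a IH|a IHa b IHb|a IHa b IHb|a IH|a IH] w /=.
- by [].
- by split=> //; split=> // /(_ I).
- by split=> //; split=> // _ [].
- by case: (IH w) => /propext pos /propext neg; rewrite pos neg not_notP.
- case: (IHa w) (IHb w) => /propext -> /propext -> [/propext -> /propext ->].
  by rewrite not_andP.
- case: (IHa w) (IHb w) => /propext -> /propext -> [/propext -> /propext ->].
  by rewrite not_orP.
- have pos v := (IH v).1; have neg v := (IH v).2.
  split; first by split=> -[v wv /pos]; exists v.
  split; first by move=> H [v wv sv]; apply: (neg v).1 (H v wv) sv.
  by move=> H v wv; apply/neg => sv; apply: H; exists v.
- have pos v := (IH v).1; have neg v := (IH v).2.
  split; first by split=> H v wv; apply/pos; apply: H.
  split; first by move=> [v wv /neg nsv] H; apply/nsv/H.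
  (* The refuting successor is obtained classically: if there were none, every successor would
     satisfy [a]. *)
  move=> H; apply: contrapT => nex; apply: H => v wv.
  by apply: contrapT => nsv; apply: nex; exists v => //; apply/neg.
Qed.

Lemma sat_nnf (A : Type) (M : kripke A) (chi : form A) (w : world M) :
  sat w (nnf chi) <-> sat w chi.
Proof. by case: (sat_nnf_nnf_neg chi w). Qed.

Section Soundness.
Variables (A : Type) (phi psi : form A) (M : kripke A).

Definition realised (w : world M) : preType A :=
  (SUBF (side_formula phi psi L) `&` [set chi | sat w chi],
   SUBF (side_formula phi psi R) `&` [set chi | sat w chi]).

Lemma component_realised (w : world M) (D : side) :
  component (realised w) D =
  SUBF (side_formula phi psi D) `&` [set chi | sat w chi].
Proof. by case: D. Qed.

Lemma locally_consistent_realised (w : world M) (D : side) :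
  locally_consistent (component (realised w) D).
Proof.
rewrite component_realised; split=> [a b|a b||p].
- move=> [/SUBF_trans sub /= [sa sb]].
  split; split=> //; apply: sub; left.
  + by left; apply: SUBF_refl.
  + by right; apply: SUBF_refl.
- move=> [/SUBF_trans sub /= [sa|sb]].
  + by left; split=> //; apply: sub; left; left; apply: SUBF_refl.
  + by right; split=> //; apply: sub; left; right; apply: SUBF_refl.
- by case.
- by case=> -[_ /= sp] [_ /=].
Qed.

Lemma step_realised (w v : world M) :
  acc w v -> step (realised w) (realised v).
Proof.
move=> wv D chi; rewrite !component_realised => -[/SUBF_trans sub /= H].
by split; [apply: sub; left; apply: SUBF_refl|apply: H].
Qed.

Lemma quasi_model_realised : quasi_model phi psi (range realised).
Proof.
split=> [_ [w _ <-] D|_ [w _ <-] p|_ D chi [w _ <-]].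
- split; last exact: locally_consistent_realised.
  by rewrite component_realised => chi [].
(* Both components record truth at the same world [w], so a clash between them would make [p] both
   true and false there. *)
- by split=> -[[_ /= ?] [_ /= ?]].
- rewrite component_realised => -[/SUBF_trans sub /= [v wv sv]].
  exists (realised v); split; [by exists v|exact: step_realised|].
  rewrite component_realised; split=> //.
  by apply: sub; left; apply: SUBF_refl.
Qed.

End Soundness.

Section Completeness.
Variables (A : Type) (phi psi : form A) (X : set (preType A)).
Hypothesis qmX : quasi_model phi psi X.

Definition quasi_kripke : kripke A :=
  @Kripke A {tau : preType A | X tau}
    (fun tau tau' => step (sval tau) (sval tau'))
    (fun p tau => exists D, component (sval tau) D (Var p)).

(** Local consistency excludes a clash within one side, overlap consistency a clash across the
    two. *)
Lemma quasi_model_no_clash (tau : preType A) (D D' : side) (p : A) :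
  X tau -> component tau D (Var p) -> component tau D' (Neg (Var p)) -> False.
Proof.
case: qmX => ty oc _ Xtau.
have [ocLR ocRL] := oc _ Xtau p.
have clash D0 : ~ (component tau D0 (Var p) /\ component tau D0 (Neg (Var p))).
  by have [_ [_ _ _]] := ty _ Xtau D0; apply.
by case: D; case: D' => pos neg;
  [apply: (clash L)|apply: ocLR|apply: ocRL|apply: (clash R)].
Qed.

(** A truth lemma in one direction only, hence the restriction to negation normal form: the
    induction hypothesis says nothing about the negation of a compound formula. The side [D] stays
    fixed throughout, since [step] and the witnesses for [Dia] respect sides. *)
Lemma sat_quasi_kripke (chi : form A) (tau : world quasi_kripke) (D : side) :
  is_nnf chi -> component (sval tau) D chi -> sat tau chi.
Proof.
case: (qmX) => ty _ dia.
elim: chi tau => [p|||a _|a IHa b IHb|a IHa b IHb|a IH|a IH] tau /=.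
- by exists D.
- by [].
- by move=> _; have [_ [_ _ nbot _]] := ty _ (svalP tau) D.
(* The letter may be true at [tau] because of either side, so [D'] can differ from [D]. *)
- case: a => // p _ neg [D' pos].
  exact: quasi_model_no_clash (svalP tau) pos neg.
- have [_ [land _ _ _]] := ty _ (svalP tau) D.
  by move=> /andP[na nb] /land[ca cb]; split; [apply: IHa|apply: IHb].
- have [_ [_ lor _ _]] := ty _ (svalP tau) D.
  by move=> /andP[na nb] /lor[ca|cb]; [left; apply: IHa|right; apply: IHb].
- move=> na /(dia _ _ _ (svalP tau))[tau' [Xtau' st ca]].
  by exists (exist _ tau' Xtau') => //; apply: IH.
- by move=> na box v st; apply: IH => //; apply: st.
Qed.

End Completeness.

Theorem theorem41 (A : Type) (phi psi : form A) :
  satisfiable (And phi (Neg psi)) <->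
  exists X : set (preType A), quasi_model phi psi X /\
    exists tau : preType A,
      [/\ X tau, component tau L (nnf phi) & component tau R (nnf (Neg psi))].
Proof.
split=> [[M [w [sphi spsi]]]|[X [qmX [tau [Xtau cL cR]]]]].
- exists (range (@realised A phi psi M)); split.
    exact: quasi_model_realised.
  exists (realised phi psi w); split; first by exists w.
  + by split; [apply: SUBF_refl|apply/sat_nnf].
  (* By computation, [~ sat w psi] is [sat w (Neg psi)]. *)
  + by split; [apply: SUBF_refl|apply/(sat_nnf (Neg psi))].
- exists (quasi_kripke X), (exist _ tau Xtau); split.
  + by apply/sat_nnf; apply: (sat_quasi_kripke qmX (D := L)) (is_nnf_nnf _) _.
  + apply/(sat_nnf (Neg psi)).
    exact: (sat_quasi_kripke qmX (D := R)) (is_nnf_nnf (Neg psi)) _.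
Qed.
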